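(* If $p \equiv 1 \pmod 6$ is prime such that $2, 3 \notin (\mathbb{Z}_p^* )^3$ and $6 \in (\mathbb{Z}_p^* )^3$, then there is a factorisation of $K_p$ into $\mathrm{Cay}(\mathbb{Z}_p; \pm\{1, 2, 3\})$.
   Context: $(\mathbb{Z}_p^* )^3=\{x^3 : x\in\mathbb{Z}_p^*\}$, the subgroup of cubes in the unit group modulo $p$. For a group $G$ and a subset $S \subseteq G$ not containing the identity and closed under inverses, the Cayley graph $\mathrm{Cay}(G;S)$ has vertex set $G$, with $g$ adjacent to $g s$ for each $s \in S$. $\pm\{a_1,\dots,a_s\}$ denotes $\{\pm a_1,\dots,\pm a_s\}$. A factorisation of a graph into $H$ is a decomposition of its edge set into edge-disjoint spanning subgraphs each isomorphic to $H$. *)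

(* Defs.v *)
From mathcomp Require Import all_boot all_algebra all_fingroup.

Set Implicit Arguments.
Unset Strict Implicit.
Unset Printing Implicit Defensive.

Import GRing.Theory.
Local Open Scope ring_scope.

(* A graph on the vertex type T is given by its adjacency relation. *)
Definition simple_graph (T : finType) (e : rel T) : Prop :=
  symmetric e /\ irreflexive e.

Definition complete_graph (T : finType) : rel T := fun x y => x != y.

Definition graph_isomorphic (T U : finType) (e : rel T) (e' : rel U) : Prop :=
  exists2 f : T -> U, bijective f & forall x y, e' (f x) (f y) = e x y.

Definition Cay (gT : finGroupType) (S : {set gT}) : rel gT :=
  fun g h => [exists s in S, h == (g * s)%g].

(* The factors F i are spanning since they are relations on the whole of T. *)
Definition is_factorisation (T U : finType) (G : rel T) (H : rel U)
    (k : nat) (F : 'I_k -> rel T) : Prop :=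
  [/\ forall i, simple_graph (F i) /\ graph_isomorphic (F i) H,
      forall x y, G x y <-> exists i, F i x y
    & forall i j x y, F i x y -> F j x y -> i = j].

Definition has_factorisation (T U : finType) (G : rel T) (H : rel U) : Prop :=
  exists (k : nat) (F : 'I_k -> rel T), is_factorisation G H F.

Definition unit_cubes (p : nat) : {set 'Z_p} :=
  [set x ^+ 3 | x : 'Z_p & x \is a GRing.unit].

Definition pm (p : nat) (A : {set 'Z_p}) : {set 'Z_p} :=
  A :|: [set - a | a in A].

Lemma Cay_simple (gT : finGroupType) (S : {set gT}) :
  1%g \notin S -> (forall s, s \in S -> (s^-1)%g \in S) ->
  simple_graph (Cay S).
Proof.
move=> S1 SV; split.
  suff sub g h : Cay S g h -> Cay S h g by move=> g h; apply/idP/idP; apply: sub.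
  case/existsP=> s /andP[sS /eqP->]; apply/existsP; exists (s^-1)%g.
  by rewrite SV // mulgK eqxx.
move=> g; apply/negbTE/negP=> /existsP[s /andP[sS]].
by rewrite -{1}[g]mulg1 => /eqP/mulgI s1; rewrite s1 sS in S1.
Qed.

(* The group law of 'Z_p as a finGroupType is addition, so that its identity is
   0 and its inverse is the opposite. *)
Lemma Cay_pm123_simple (p : nat) : (3 < p)%N ->
  simple_graph (Cay (pm [set 1; 2%:R; 3%:R] : {set 'Z_p})).
Proof.
move=> p3; have p1 : (1 < p)%N by apply: leq_trans p3.
have nz n : (0 < n <= 3)%N -> (n%:R == 0 :> 'Z_p) = false.
  case/andP=> n0 n3; rewrite -val_eqE /= val_Zp_nat // modn_small.
    by rewrite eqn0Ngt n0.
  exact: leq_ltn_trans n3 p3.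
apply: Cay_simple.
  rewrite -[1%g]/(0 : 'Z_p); apply/negP; rewrite inE => /orP[|/imsetP[a]].
    by rewrite !inE ![0 == _]eq_sym -[1]/(1%:R) !nz.
  rewrite !inE -[1]/(1%:R) => aS /eqP; rewrite eq_sym oppr_eq0 => /eqP a0.
  by move: aS; rewrite a0 ![0 == _]eq_sym !nz.
move=> s; rewrite -[(s^-1)%g]/(- s) => /setUP[sA | /imsetP[a aA ->]].
  by apply/setUP; right; apply: imset_f.
by apply/setUP; left; rewrite opprK.
Qed.

(* Main.v *)
Require Import Defs.
From mathcomp Require Import all_boot all_algebra all_fingroup.
From mathcomp Require Import cyclic ring zify.

(** Let [H] be the group of cubes.  As the unit group is cyclic, [2] not in [H]
    makes [H], [2H], [4H] cover the units, and [4H = 3H] because [6] and [8] are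
    cubes; hence [1], [2], [3] represent the three cosets of [H].  Choosing one
    element from each pair [{h, -h}] in [H] gives a set [T] such that every
    nonzero residue is uniquely [t * s] with [t] in [T] and [s] in
    [±{1, 2, 3}].  The factors are the Cayley graphs of the sets [t * ±{1, 2, 3}],
    all isomorphic by scaling. *)

Set Implicit Arguments.
Unset Strict Implicit.
Unset Printing Implicit Defensive.

Import GRing.Theory.
Local Open Scope ring_scope.

Lemma Cay_ZpE (p : nat) (S : {set 'Z_p}) x y : Cay S x y = (y - x \in S).
Proof.
apply/existsP/idP => [[s /andP[sS /eqP->]]|yxS].
  by rewrite -[(x * s)%g]/(x + s) addrAC subrr add0r.
exists (y - x); rewrite yxS /=; apply/eqP.
by rewrite -[(x * (y - x))%g]/(x + (y - x)) addrC subrK.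
Qed.

(** The sets [t * S] tile the nonzero residues, so each nonzero difference [y - x] selects exactly
    one factor. Multiplication by [t^-1] maps the factor of [t] onto [Cay S]. *)
Lemma tiling_factorisation (p : nat) (S T : {set 'Z_p}) :
    {in S, forall s, - s \in S} ->
    {in T, forall t, t \is a GRing.unit} ->
    (forall x, x != 0 <-> exists2 t, t \in T & t^-1 * x \in S) ->
    (forall x, {in T &, forall t u, t^-1 * x \in S -> u^-1 * x \in S -> t = u}) ->
  has_factorisation (@complete_graph 'Z_p) (Cay S).
Proof.
move=> SN Tunit cover disj.
exists #|T|, (fun i x y => (enum_val i)^-1 * (y - x) \in S); split.
- move=> i; have tT := enum_valP i; have tU := Tunit _ tT.
  split; last first.
    exists (fun x => (enum_val i)^-1 * x).
      exists (fun x => enum_val i * x) => x; first by rewrite mulVKr.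
      by rewrite mulKr.
    by move=> x y; rewrite Cay_ZpE mulrBr.
  split=> [x y|x].
    by apply/idP/idP => /SN; rewrite -mulrN opprB.
  (* No loops: the covering hypothesis at 0 keeps 0 out of every [t * S]. *)
  apply/negP => xS; have [_] := cover 0.
  by rewrite eqxx => /(_ _)/notF; apply; exists (enum_val i); rewrite // -(subrr x).
- move=> x y; rewrite /complete_graph eq_sym -subr_eq0 cover; split.
    case=> t tT tS; exists (enum_rank_in tT t).
    by rewrite enum_rankK_in.
  by case=> i iS; exists (enum_val i); rewrite ?enum_valP.
move=> i j x y iS jS; apply: enum_val_inj.
by apply: (disj (y - x)) => //; apply: enum_valP.
Qed.

Section UnitCubes.

Variables (p : nat) (p_prime : prime p).
Implicit Types x y : 'Z_p.

Local Notation H := (unit_cubes p).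

Lemma unit_Zp_prime x : (x \is a GRing.unit) = (x != 0).
Proof.
have p1 := prime_gt1 p_prime.
by rewrite -[x]natr_Zp unitZpE // prime_coprime // -val_eqE /= val_Zp_nat.
Qed.

Lemma unit_cubesP x :
  reflect (exists2 y, y \is a GRing.unit & x = y ^+ 3) (x \in H).
Proof.
by apply: (iffP imsetP) => -[y yU ->]; exists y; rewrite // inE in yU *.
Qed.

Lemma unit_cubes_unit x : x \in H -> x \is a GRing.unit.
Proof. by case/unit_cubesP => y yU ->; rewrite unitrX. Qed.

Lemma unit_cubesM x y : x \in H -> y \in H -> x * y \in H.
Proof.
case/unit_cubesP => u uU -> /unit_cubesP[v vU ->]; apply/unit_cubesP.
by exists (u * v); rewrite ?unitrM ?uU // exprMn.
Qed.

Lemma unit_cubesV x : x \in H -> x^-1 \in H.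
Proof.
case/unit_cubesP => u uU ->; apply/unit_cubesP.
by exists u^-1; rewrite ?unitrV // exprVn.
Qed.

Lemma unit_cubesN x : x \in H -> - x \in H.
Proof.
case/unit_cubesP => u uU ->; apply/unit_cubesP.
by exists (- u); rewrite ?unitrN //; ring.
Qed.

Lemma unit_cubesX3 x : x \is a GRing.unit -> x ^+ 3 \in H.
Proof. by move=> xU; apply/unit_cubesP; exists x. Qed.

(** Here [x] is the quotient of the cubes [x ^+ 3] and [x * x]. *)
Lemma unit_cubes_of_square x :
  x \is a GRing.unit -> x * x \in H -> x \in H.
Proof.
move=> xU xxH; have := unit_cubesM (unit_cubesX3 xU) (unit_cubesV xxH).
by rewrite exprS expr2 mulrK ?unitrM ?xU.
Qed.

(** With a generator [g], write [a = g ^ m] and [x = g ^ n]. As 3 does not divide [m], it divides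
    one of [n], [n + m], [n + 2m]. *)
Lemma unit_cubes_cosets a x :
    a \is a GRing.unit -> x \is a GRing.unit -> a \notin H ->
  [|| x \in H, x * a \in H | x * a ^+ 2 \in H].
Proof.
move=> aU xU aH.
have [g gP] := cyclicP (units_Zp_cyclic p_prime).
have expg y : y \is a GRing.unit -> exists n, y = val g ^+ n.
  move=> yU; have: FinRing.Unit yU \in <[g]>%g by rewrite -gP inE.
  by case/cycleP=> n /(congr1 val); rewrite /= FinRing.val_unitX; exists n.
have gH n : (3 %| n)%N -> val g ^+ n \in H.
  by case/dvdnP=> m ->; rewrite exprM unit_cubesX3 // unitrX //; apply: valP.
have [m am] := expg a aU; have [n xn] := expg x xU.
have m3 : ~~ (3 %| m)%N by apply: contra aH => /gH; rewrite -am.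
rewrite am xn -exprM -!exprD.
have : [|| 3 %| n, 3 %| n + m | 3 %| n + m * 2]%N by lia.
by case/or3P=> /gH ->; rewrite ?orbT.
Qed.

End UnitCubes.

Theorem theorem3 (p : nat) (p_prime : prime p) (p_mod6 : p = 1 %[mod 6])
    (cube2 : (2%:R : 'Z_p) \notin unit_cubes p)
    (cube3 : (3%:R : 'Z_p) \notin unit_cubes p)
    (cube6 : (6%:R : 'Z_p) \in unit_cubes p) :
  has_factorisation (@complete_graph 'I_p)
    (@Cay 'Z_p (@pm p [set 1; 2%:R; 3%:R])).
Proof.
(* The types ['I_p] and ['Z_p] become convertible once [p] has the form [q.+2]. *)
suff: has_factorisation (@complete_graph 'Z_p)
    (@Cay 'Z_p (@pm p [set 1; 2%:R; 3%:R])).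
  by case: p p_prime {p_mod6 cube2 cube3 cube6} => [|[|q]].
set A : {set 'Z_p} := [set 1; 2%:R; 3%:R].
have U6 := unit_cubes_unit cube6.
have [U2 U3] : (2%:R : 'Z_p) \is a GRing.unit /\ (3%:R : 'Z_p) \is a GRing.unit.
  by apply/andP; rewrite -unitrM -natrM.
have AP a : a \in A -> [\/ a = 1, a = 2%:R | a = 3%:R].
  by rewrite !inE => /orP[/orP[]|] /eqP->; [exact: Or31 | exact: Or32 | exact: Or33].
have AU a : a \in A -> a \is a GRing.unit by case/AP=> ->; rewrite ?unitr1.
have A_cosets u : u \in unit_cubes p -> {in A &, forall a b, a = u * b -> a = b}.
  move=> uH a b /AP[] -> /AP[] -> //.
  - move=> e; have := unit_cubesV uH.
    by rewrite -[u^-1]mulr1 e mulKr ?(unit_cubes_unit uH) // (negbTE cube2).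
  - move=> e; have := unit_cubesV uH.
    by rewrite -[u^-1]mulr1 e mulKr ?(unit_cubes_unit uH) // (negbTE cube3).
  - by rewrite mulr1 => e; rewrite e uH in cube2.
  (* If [2 = u * 3], then [2 * 2 = u * 6] is a cube, hence so is 2. The case [3 = u * 2] is
     symmetric. *)
  - move=> e; have /negP[] := cube2; apply: unit_cubes_of_square => //.
    by rewrite {1}e -mulrA -natrM unit_cubesM.
  - by rewrite mulr1 => e; rewrite e uH in cube3.
  - move=> e; have /negP[] := cube3; apply: unit_cubes_of_square => //.
    by rewrite {1}e -mulrA -natrM unit_cubesM.
have A_cover x : x \is a GRing.unit -> exists2 a, a \in A & a^-1 * x \in unit_cubes p.
  (* The cases [x], [2x], [4x] in H give [a] = 1, 3, 2 in turn, since [x/3 = 2x/6] and [x/2 = 4x/8]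
     with 6 and 8 cubes. *)
  move=> xU; case/or3P: (unit_cubes_cosets p_prime U2 xU cube2) => xH.
  - by exists 1; rewrite ?invr1 ?mul1r // !inE eqxx.
  - exists 3%:R; first by rewrite !inE eqxx !orbT.
    have := unit_cubesM xH (unit_cubesV cube6).
    by rewrite (natrM _ 2 3) invrM // mulrA mulrAC mulrK // mulrC.
  - exists 2%:R; first by rewrite !inE eqxx !orbT.
    have := unit_cubesM xH (unit_cubesV (unit_cubesX3 U2)).
    by rewrite (exprSr _ 2) invrM ?unitrX // mulrA mulrAC mulrK ?unitrX // mulrC.
have pmP x : reflect (exists2 a, a \in A & x = a \/ x = - a) (x \in pm A).
  rewrite inE; apply: (iffP orP) => [[xA|/imsetP[a aA ->]]|[a aA [->|->]]].
  - by exists x; [|left].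
  - by exists a; [|right].
  - by left.
  - by right; apply: imset_f.
have pmN : {in pm A, forall s, - s \in pm A}.
  move=> s /pmP[a aA e]; apply/pmP; exists a => //.
  by case: e => ->; [right | left; rewrite opprK].
(* From each pair [{h, -h}] the element with the smaller representative below [p] is taken. *)
pose T := [set t in unit_cubes p | (val t < val (- t)%R)%N].
have TH t : t \in T -> t \in unit_cubes p by rewrite inE => /andP[].
have TU t : t \in T -> t \is a GRing.unit by move/TH/unit_cubes_unit.
have TN t : t \in T -> - t \in T -> False.
  rewrite !inE opprK => /andP[_ lt1] /andP[_ lt2].
  by have := ltn_trans lt1 lt2; rewrite ltnn.
have T_half h : h \in unit_cubes p -> h \in T \/ - h \in T.
  move=> hH; rewrite !inE hH unit_cubesN // !andTb opprK.
  case: ltngtP => [||e]; [by left | by right |].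
  (* A tie means [h = -h], so [h * 2 = 0], although [h] and 2 are units. *)
  have hU := unit_cubes_unit hH.
  have /eqP : h + h = 0 by rewrite {2}(val_inj e) subrr.
  rewrite -mulr2n -mulr_natr => /eqP h2.
  have : (h * 2%:R) \is a GRing.unit by rewrite unitrM hU.
  by rewrite h2 unitr0.
apply: (tiling_factorisation (T := T)) => //.
  move=> x; split=> [x0|[t tT /pmP[a aA e]]].
    have xU : x \is a GRing.unit by rewrite unit_Zp_prime.
    have [a aA axH] := A_cover x xU.
    have aU := AU a aA.
    have e : (a^-1 * x)^-1 * x = a.
      by rewrite invrM ?unitrV // invrK mulrAC mulVr ?mul1r.
    (* With [h = a^-1 * x], both [x = h * a] and [x = (- h) * (- a)] hold, so whichever of [h],
       [- h] lies in [T] serves. *)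
    case: (T_half _ axH) => tT.
      by exists (a^-1 * x) => //; apply/pmP; exists a; [|left].
    exists (- (a^-1 * x)) => //; apply/pmP; exists a => //.
    by right; rewrite invrN mulNr e.
  have : t^-1 * x \is a GRing.unit by case: e => ->; rewrite ?unitrN AU.
  by rewrite unitrM unit_Zp_prime // => /andP[_]; rewrite unit_Zp_prime.
(* The sign moves from [a] to [t], leaving a cube times an element of [A], to which [A_cosets]
   applies. *)
have split_pm x t : t \in T -> t^-1 * x \in pm A ->
    exists2 v, v \in unit_cubes p /\ (v = t \/ v = - t)
      & exists2 a, a \in A & x = v * a.
  move=> tT /pmP[a aA e]; have ex : x = t * (t^-1 * x) by rewrite mulVKr ?TU.
  case: e => e; [exists t | exists (- t)]; rewrite ?unit_cubesN ?TH //; auto.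
    by exists a; rewrite // ex e.
  by exists a; rewrite // ex e mulrN mulNr.
move=> x t u tT uT.
case/(split_pm _ _ tT)=> v [vH vt] [a aA xa] /(split_pm _ _ uT)[w [wH wu] [b bA xb]].
have vU := unit_cubes_unit vH.
have ab : a = b.
  apply: (A_cosets (v^-1 * w)) => //; first by rewrite unit_cubesM ?unit_cubesV.
  by rewrite -mulrA -xb xa mulKr.
have vw : v = w by apply: (mulIr (AU b bA)); rewrite -xb xa ab.
(* Now [t = u] or [t = - u]; the latter would put an element and its opposite both in [T]. *)
case: vt wu => vt [] wu; move: vw; rewrite vt wu // => vw.
- by case: (TN u); rewrite // -vw.
- by case: (TN t); rewrite // vw.
exact: oppr_inj.
Qed.
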